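(* Let $K$ be a tame, prime and alternating knot with a regular and common (alternating) projection, and let $\Re''$ be the rewriting system associated with this projection as defined in the context. Then $\Re''$ is finite and complete.
   Context: Projection. The projection $\wp(K)\subset\mathbb{R}^2$ is regular (finitely many multiple points, all transverse double points, called crossings; a 4-valent plane graph) and alternating. The domains are the components of $\mathbb{R}^2\setminus\wp(K)$, labelled $x_0,\dots,x_n$ with $x_0$ unbounded. It is common: the boundaries of two distinct domains have at most one edge in common, and each crossing is on the boundary of exactly four distinct domains. Prime knots are nontrivial, so there is at least one crossing. Write $\overline{x}$ for the formal inverse of $x$. At each crossing four domains $x_a,x_b,x_c,x_d$ meet in this cyclic order, labelled so that the overcrossing strand separates $x_a$ from $x_b$; the Dehn relator of the crossing is $x_a\overline{x_b}x_c\overline{x_d}$. Sources and sinks. Colour the domains like a chessboard (domains sharing an edge have different colours). Domains of the colour of $x_0$ are sources, the others are sinks. Rename $x_i$ as $s_i$ if it is a source and as $t_i$ if it is a sink. Up to inversion and cyclic permutation the relator of a crossing has the normalized form $s_i\overline{t_j}s_k\overline{t_l}$, unique up to exchanging $(i,j)$ with $(k,l)$. Neighbours of $x_0$. Call a sink $t_l$ outer if its domain shares an edge with $x_0$. By the hypotheses, for every outer $t_l$ there is exactly one crossing whose normalized relator is $s_0\overline{t_j}s_k\overline{t_l}$ for some $j,k$; put $\sigma(l)=j$, $\kappa(l)=k$ (then $t_{\sigma(l)}$ is again outer). For a sink $t_q$ let $T(q)$ be the word $\overline{t_{\sigma(q)}}\,s_{\kappa(q)}$ if $t_q$ is outer,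 and $t_q$ otherwise. The system $\Re''$ on the alphabet $\{x_1,\dots,x_n,\overline{x_1},\dots,\overline{x_n}\}$ consists of the following rules. (0) $x_i\overline{x_i}\to1$ and $\overline{x_i}x_i\to1$ for $1\le i\le n$. For each outer $t_l$, with $j=\sigma(l)$, $k=\kappa(l)$, $l'=\sigma(j)$, $k'=\kappa(j)$: (1) $t_l\to\overline{t_j}s_k$; (2') $s_k\overline{t_l}\to\overline{t_{l'}}s_{k'}$; (3) $\overline{t_l}\,\overline{t_j}\to\overline{s_k}$; (4) $\overline{s_k}\,\overline{t_{l'}}\to\overline{t_l}\,\overline{s_{k'}}$. For each crossing not on the boundary of $x_0$ and each of the two ways of writing its normalized relator as $s_m\overline{t_p}s_{m'}\overline{t_q}$: (a) $s_m\overline{t_p}\to T(q)\,\overline{s_{m'}}$; (b) if $t_q$ is not outer: $\overline{s_m}t_q\to\overline{t_p}s_{m'}$; (5) if $t_q$ is outer: $\overline{s_m}\,\overline{t_{\sigma(q)}}\to\overline{t_p}s_{m'}\overline{s_{\kappa(q)}}$. Rewriting terminology. $ulv\to urv$ for each rule $l\to r$ and all words $u,v$; $\to^*$ is the reflexive transitive closure. A system is terminating if there is no infinite sequence $w_1\to w_2\to\cdots$; locally confluent if $w\to u$ and $w\to v$ imply $u\to^*z$ and $v\to^*z$ for some $z$; complete if terminating and locally confluent. *)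

(* Defs.v *)
From HB Require Import structures.
From Stdlib Require Import Relation_Operators.
From mathcomp Require Export all_boot all_order all_algebra.
From mathcomp Require Export all_classical all_reals all_analysis.
Set Implicit Arguments.
Unset Strict Implicit.
Unset Printing Implicit Defensive.
Import Order.TTheory GRing.Theory Num.Theory.
Import numFieldNormedType.Exports.
Local Open Scope classical_set_scope.
Local Open Scope ring_scope.

Notation R2 R := (R * R)%type.
(* A point of R^3 is a pair of its projection and its height. *)
Notation R3 R := (R2 R * R)%type.

Section Knots.
Variable R : realType.

Definition homeomorphism (T : topologicalType) (f : T -> T) : Prop :=
  continuous f /\ exists2 g : T -> T, continuous g & cancel f g /\ cancel g f.

Definition equivalent (K L : set (R3 R)) : Prop :=
  exists2 f : R3 R -> R3 R, homeomorphism f & L = f @` K.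

(* The circle is R/Z: gamma is 1-periodic and injective modulo 1. *)
Definition parametrizes (gamma : R -> R3 R) (K : set (R3 R)) : Prop :=
  [/\ continuous gamma,
      (forall s t, gamma s = gamma t <-> t - s \is a Num.int)
    & K = range gamma].

Definition knot (K : set (R3 R)) : Prop := exists gamma, parametrizes gamma K.

Definition segment (a b : R3 R) : set (R3 R) :=
  [set (1 - t) *: a + t *: b | t in `[0, 1]].

Definition polygonal (K : set (R3 R)) : Prop :=
  exists s : seq (R3 R * R3 R),
    K = [set v | exists2 ab, ab \in s & segment ab.1 ab.2 v].

Definition tame (K : set (R3 R)) : Prop :=
  exists2 P, polygonal P & equivalent K P.

Definition circle : set (R3 R) :=
  [set v | v.1.1 ^+ 2 + v.1.2 ^+ 2 = 1 /\ v.2 = 0].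

Definition trivial_knot (K : set (R3 R)) : Prop := equivalent K circle.

(* K is the product of two nontrivial knots: a polygonal representative of K
   meets a plane (here the plane of height 0) in exactly two points, and each
   of the two arcs it is cut into becomes a nontrivial knot when it is closed
   up by an arc of the plane. *)
Definition composite (K : set (R3 R)) : Prop :=
  exists P : set (R3 R), exists a b : R3 R,
    [/\ equivalent K P, polygonal P, a <> b,
        P `&` [set v | v.2 = 0] = [set a; b]
      & let upper := P `&` [set v | 0 <= v.2] `|` segment a b in
        let lower := P `&` [set v | v.2 <= 0] `|` segment a b in
        [/\ knot upper, ~ trivial_knot upper,
            knot lower & ~ trivial_knot lower]].

Definition prime_knot (K : set (R3 R)) : Prop :=
  [/\ knot K, ~ trivial_knot K & ~ composite K].

Definition projection (K : set (R3 R)) : set (R2 R) := fst @` K.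

Definition crossing (K : set (R3 R)) (p : R2 R) : Prop :=
  exists u v, [/\ K u, K v, u <> v, u.1 = p & v.1 = p].

Definition overcrossing (K : set (R3 R)) (u : R3 R) : Prop :=
  exists v, [/\ K v, v.1 = u.1 & v.2 < u.2].

Definition open_square (e : R) : set (R2 R) :=
  [set q | `|q.1| < e /\ `|q.2| < e].

(* Near gamma t the projection is a single flat arc: h straightens it to
   a piece of the first axis. *)
Definition flat_chart (gamma : R -> R3 R) (t : R)
    (h : R2 R -> R2 R) (e : R) : Prop :=
  [/\ homeomorphism h, 0 < e,
      forall s, `|s| < e -> h (gamma (t + s)).1 = (s, 0)
    & forall r, open_square e (h (gamma r).1) ->
        exists2 s, `|s| < e & gamma r = gamma (t + s)].

(* A transverse double point with over-parameter t and under-parameter t':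
   h carries the overcrossing strand to the first axis and the undercrossing
   strand to the second one, and nothing else of the knot lies over the
   square.  No orientation is imposed on h, so only the directions of the two
   strands, and not the handedness of the crossing, are normalized. *)
Definition crossing_chart (gamma : R -> R3 R) (p : R2 R) (t t' : R)
    (h : R2 R -> R2 R) (e : R) : Prop :=
  [/\ [/\ (gamma t).1 = p, (gamma t').1 = p & (gamma t').2 < (gamma t).2],
      homeomorphism h /\ 0 < e,
      forall s, `|s| < e -> h (gamma (t + s)).1 = (s, 0),
      forall s, `|s| < e -> h (gamma (t' + s)).1 = (0, s)
    & forall r, open_square e (h (gamma r).1) ->
        exists2 s, `|s| < e &
          gamma r = gamma (t + s) \/ gamma r = gamma (t' + s)].

(* The last clause of crossing_chart makes every multiple point double.  By
   the Schoenflies theorem the third condition below holds automatically and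
   the charts may be taken to be homeomorphisms of the whole plane; the
   condition is spelled out because that theorem is not available here. *)
Definition regular_projection (gamma : R -> R3 R) (K : set (R3 R)) : Prop :=
  [/\ finite_set (crossing K),
      forall p, crossing K p ->
        exists t t' h e, crossing_chart gamma p t t' h e
    & forall t, ~ crossing K (gamma t).1 ->
        exists h e, flat_chart gamma t h e].

Definition consecutive (gamma : R -> R3 R) (K : set (R3 R)) (a b : R) : Prop :=
  [/\ a < b, crossing K (gamma a).1, crossing K (gamma b).1
    & forall t, a < t < b -> ~ crossing K (gamma t).1].

Definition alternating_projection (gamma : R -> R3 R) (K : set (R3 R)) : Prop :=
  forall a b, consecutive gamma K a b ->
    (overcrossing K (gamma a) <-> ~ overcrossing K (gamma b)).

Definition edge (gamma : R -> R3 R) (K : set (R3 R)) (E : set (R2 R)) : Prop :=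
  exists a b, consecutive gamma K a b /\
    E = (fun t => (gamma t).1) @` [set t | a < t < b].

Definition boundary (A : set (R2 R)) : set (R2 R) :=
  closure A `\` interior A.

Definition domains (K : set (R3 R)) n (x : 'I_n.+1 -> set (R2 R)) : Prop :=
  [/\ injective x,
      forall A : set (R2 R), (exists i, A = x i) <->
        (exists2 q, ~ projection K q
                  & A = connected_component (~` projection K) q)
    & ~ bounded_set (x ord0)].

Definition common_edge (gamma : R -> R3 R) (K : set (R3 R))
    (A B : set (R2 R)) (E : set (R2 R)) : Prop :=
  [/\ edge gamma K E, E `<=` boundary A & E `<=` boundary B].

Definition common (gamma : R -> R3 R) (K : set (R3 R)) n
    (x : 'I_n.+1 -> set (R2 R)) : Prop :=
  (forall i j E E', i != j -> common_edge gamma K (x i) (x j) E ->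
     common_edge gamma K (x i) (x j) E' -> E = E') /\
  (forall p, crossing K p -> exists2 s : {set 'I_n.+1}, #|s| = 4%N &
     forall i, i \in s <-> boundary (x i) p).

Definition chessboard (gamma : R -> R3 R) (K : set (R3 R)) n
    (x : 'I_n.+1 -> set (R2 R)) (col : 'I_n.+1 -> bool) : Prop :=
  forall i j E, i != j -> common_edge gamma K (x i) (x j) E -> col i != col j.

Definition quadrant (h : R2 R -> R2 R) (e : R)
    (b1 b2 : bool) : set (R2 R) :=
  [set q | [/\ open_square e (h q), 0 < (-1) ^+ b1 * (h q).1
             & 0 < (-1) ^+ b2 * (h q).2]].

End Knots.

(* A letter is an index with a flag that tells whether it is inverted. *)
Definition letter (I : Type) : Type := (I * bool)%type.
Definition word (I : Type) : Type := seq (letter I).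
Definition pos {I : Type} (i : I) : letter I := (i, false).
Definition neg {I : Type} (i : I) : letter I := (i, true).
Definition inverse_word {I : Type} (w : word I) : word I :=
  rev [seq (a.1, ~~ a.2) | a <- w].

Section Rewriting.
Variable W : Type.

Definition rewriting_system : Type := seq W -> seq W -> Prop.

Variable S : rewriting_system.

Definition step (w w' : seq W) : Prop :=
  exists u v l r, [/\ S l r, w = u ++ l ++ v & w' = u ++ r ++ v].

Definition steps : seq W -> seq W -> Prop := clos_refl_trans (seq W) step.

Definition terminating : Prop :=
  ~ exists w : nat -> seq W, forall i, step (w i) (w i.+1).

Definition locally_confluent : Prop :=
  forall w u v, step w u -> step w v -> exists2 z, steps u z & steps v z.

Definition complete_system : Prop := terminating /\ locally_confluent.

Definition finite_system : Prop :=
  finite_set [set lr : seq W * seq W | S lr.1 lr.2].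

End Rewriting.

Section System.
Variables (R : realType) (gamma : R -> R3 R) (K : set (R3 R)) (n : nat).
Variables (x : 'I_n.+1 -> set (R2 R)) (col : 'I_n.+1 -> bool).

Definition source (i : 'I_n.+1) : Prop := col i = col ord0.
Definition sink (i : 'I_n.+1) : Prop := col i <> col ord0.

(* The overcrossing strand is the first axis of the chart, so it separates
   quadrants that differ in the second sign. *)
Definition dehn_relator (p : R2 R) (r : word 'I_n.+1) : Prop :=
  exists a b c d,
    r = [:: pos a; neg b; pos c; neg d] /\
    exists t t' h e b1 b2,
      [/\ crossing_chart gamma p t t' h e,
          quadrant h e b1 b2 `<=` x a,
          quadrant h e b1 (~~ b2) `<=` x b,
          quadrant h e (~~ b1) (~~ b2) `<=` x c
        & quadrant h e (~~ b1) b2 `<=` x d].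

Definition normalized (p : R2 R) (i j k l : 'I_n.+1) : Prop :=
  [/\ crossing K p, source i /\ source k, sink j /\ sink l &
      exists r m, dehn_relator p r /\
        ([:: pos i; neg j; pos k; neg l] = rot m r \/
         [:: pos i; neg j; pos k; neg l] = rot m (inverse_word r))].

(* The letter i : 'I_n of the rewriting system stands for the domain of index
   i + 1; the domain x_0 has no letter. *)
Definition domain_of (i : 'I_n) : 'I_n.+1 := lift ord0 i.

Definition outer (q : 'I_n) : Prop :=
  sink (domain_of q) /\ exists E, common_edge gamma K (x ord0) (x (domain_of q)) E.

(* t_l is outer, j = sigma(l) and k = kappa(l). *)
Definition sigma_kappa (l j k : 'I_n) : Prop :=
  outer l /\ exists p, normalized p ord0 (domain_of j) (domain_of k) (domain_of l).

(* w is the word T(q). *)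
Definition Tword (q : 'I_n) (w : word 'I_n) : Prop :=
  (exists j k, sigma_kappa q j k /\ w = [:: neg j; pos k]) \/
  (~ outer q /\ w = [:: pos q]).

(* The two ways of writing a normalized relator need no separate mention,
   since normalized c m p m' q is invariant under (m, p) <-> (m', q). *)
Definition inner_relator (m p m' q : 'I_n) : Prop :=
  exists2 c, ~ boundary (x ord0) c &
    normalized c (domain_of m) (domain_of p) (domain_of m') (domain_of q).

Inductive Re'' : rewriting_system (letter 'I_n) :=
| rule0 i : Re'' [:: pos i; neg i] [::]
| rule0' i : Re'' [:: neg i; pos i] [::]
| rule1 l j k : sigma_kappa l j k ->
    Re'' [:: pos l] [:: neg j; pos k]
| rule2' l j k l' k' : sigma_kappa l j k -> sigma_kappa j l' k' ->
    Re'' [:: pos k; neg l] [:: neg l'; pos k']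
| rule3 l j k : sigma_kappa l j k ->
    Re'' [:: neg l; neg j] [:: neg k]
| rule4 l j k l' k' : sigma_kappa l j k -> sigma_kappa j l' k' ->
    Re'' [:: neg k; neg l'] [:: neg l; neg k']
| rulea m p m' q w : inner_relator m p m' q -> Tword q w ->
    Re'' [:: pos m; neg p] (rcons w (neg m'))
| ruleb m p m' q : inner_relator m p m' q -> ~ outer q ->
    Re'' [:: neg m; pos q] [:: neg p; pos m']
| rule5 m p m' q j k : inner_relator m p m' q -> sigma_kappa q j k ->
    Re'' [:: neg m; neg j] [:: neg p; pos m'; neg k].

End System.

(* Main.v *)
(** Termination.  Read a word from left to right, adding one at a source and
    tripling at a sink (3 m + 2 at a positive outer sink): every rule lowers
    the value of a word.

    Confluence.  Along an edge the domain on each side is constant, so the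
    edges leaving a crossing of relator [s_i t_j^-1 s_k t_l^-1] separate the
    domains that are consecutive around it: [s_i] and [t_j] share an edge which
    passes over there, [s_i] and [t_l] one which passes under.  Since two domains
    share at most one edge and an alternating edge is over at exactly one of
    its ends, each of the pairs [(i, j)] and [(i, l)] determines the crossing,
    and then the relator, because four distinct domains meet there.  Hence sigma
    and kappa are functions, sigma is injective, the left-hand sides are
    pairwise distinct, and the remaining critical pairs are resolved. *)
From HB Require Import structures.
From Stdlib Require Import Relation_Operators.
Require Import Defs.
From mathcomp Require Import ring lra zify.
Set Implicit Arguments.
Unset Strict Implicit.
Unset Printing Implicit Defensive.
Import Order.TTheory GRing.Theory Num.Theory.
Import numFieldNormedType.Exports.
Local Open Scope classical_set_scope.
Local Open Scope ring_scope.

Lemma connected_setX (T U : topologicalType) (A : set T) (B : set U) :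
  connected A -> connected B -> connected (A `*` B).
Proof.
move=> cA cB; have [[[a b0] [/= Aa Bb0]]|AB0] := pselect (A `*` B !=set0); last first.
  by move/nonemptyPn: AB0 => ->; exact: connected0.
have -> : A `*` B =
    \bigcup_(b in B) ((fun t => (t, b)) @` A `|` (fun u => (a, u)) @` B).
  rewrite eqEsubset; split=> [[t u] [/= At Bu]|z [b Bb [[t At <-]|[u Bu <-]]]] //.
  by exists u => //; left; exists t.
apply: bigcup_connected => [|b Bb].
  by exists (a, b0) => b Bb; right; exists b0.
apply: connectedU.
- by exists (a, b); split; [exists a | exists b].
- apply: connected_continuous_connected => //.
  apply: continuous_subspaceT => t.
  by apply: cvg_pair => /=; [exact: cvg_id | exact: cvg_cst].
- apply: connected_continuous_connected => //.
  apply: continuous_subspaceT => t.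
  by apply: cvg_pair => /=; [exact: cvg_cst | exact: cvg_id].
Qed.

Lemma preimage_connected (T : topologicalType) (h : T -> T) (A : set T) :
  homeomorphism h -> connected A -> connected (h @^-1` A).
Proof.
move=> [_ [g cg [hK gK]]] cA.
have -> : h @^-1` A = g @` A.
  rewrite eqEsubset; split=> [z Az|_ [z Az <-]]; last by rewrite /= gK.
  by exists (h z); rewrite ?hK.
by apply: connected_continuous_connected => //; exact: continuous_subspaceT.
Qed.

Lemma homeomorphism_inj (T : topologicalType) (h : T -> T) :
  homeomorphism h -> injective h.
Proof. by move=> [_ [g _ [hK _]]]; exact: can_inj hK. Qed.

(** * Charts of the projection *)

Section HalfIntervals.
Variable R : realType.

(* [half e false] is ]0, e[ and [half e true] is ]-e, 0[. *)
Definition half (e : R) (b : bool) : set R :=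
  [set s | `|s| < e /\ 0 < (-1) ^+ b * s].

Lemma half_connected e b : connected (half e b).
Proof.
apply/connected_intervalP => s t [se s0] [te t0] r /andP[sr rt]; split.
  by move: se te; rewrite !ltr_norml => /andP[? ?] /andP[? ?]; apply/andP; split; lra.
by case: b s0 t0; rewrite /= ?expr1 ?expr0; lra.
Qed.

Lemma ball0_connected (e : R) : connected [set s : R | `|s| < e].
Proof.
apply/connected_intervalP => s t /= se te r /andP[sr rt].
by move: se te; rewrite !ltr_norml => /andP[? ?] /andP[? ?]; apply/andP; split; lra.
Qed.

Lemma half_neq0 (s : R) : s != 0 -> exists b : bool, 0 < (-1) ^+ b * s.
Proof.
rewrite neq_lt => /orP[s0|s0]; [exists true|exists false];
  rewrite /= ?expr1 ?expr0; lra.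
Qed.

Lemma quadrantE (h : R2 R -> R2 R) e b1 b2 :
  quadrant h e b1 b2 = h @^-1` (half e b1 `*` half e b2).
Proof.
rewrite eqEsubset; split=> z; first by move=> [[? ?] ? ?].
by move=> [[? ?] [? ?]].
Qed.

Lemma quadrant_connected (h : R2 R -> R2 R) e b1 b2 :
  homeomorphism h -> connected (quadrant h e b1 b2).
Proof.
move=> hh; rewrite quadrantE; apply: preimage_connected => //.
by apply: connected_setX; exact: half_connected.
Qed.

Lemma half_small (e d : R) b : 0 < e -> 0 < d -> half e b ((-1) ^+ b * Num.min e d / 2).
Proof.
move=> e0 d0; have m0 : 0 < Num.min e d by rewrite lt_min e0.
have me : Num.min e d <= e by rewrite ge_min lexx.
split; last by case: b; rewrite /= ?expr1 ?expr0; lra.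
by rewrite ltr_norml; case: b; rewrite /= ?expr1 ?expr0; apply/andP; split; lra.
Qed.

Lemma closure_half (h : R2 R -> R2 R) e b s z (I : set R) : homeomorphism h -> 0 < e ->
  I s -> h z = (s, 0) -> closure (h @^-1` (I `*` half e b)) z.
Proof.
move=> [_ [g cg [hK gK]]] e0 Is hz U Uz.
have : nbhs (s, 0 : R) (g @^-1` U) by apply: cg; rewrite -hz hK.
move=> /nbhs_ballP[d /= d0 dU].
pose u := (-1) ^+ b * Num.min e d / 2.
have [ue u0] := half_small b e0 d0.
have ud : `|u| < d.
  by rewrite /u minC; case: (half_small b d0 e0).
exists (g (s, u)); split; first by rewrite /= gK; split.
apply: dU; split => /=; first exact: ballxx.
by rewrite /ball /= sub0r normrN.
Qed.

Lemma open_rect (h : R2 R -> R2 R) (A B : set R) :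
  homeomorphism h -> open A -> open B -> open (h @^-1` (A `*` B)).
Proof.
move=> [ch _] oA oB; apply: open_comp => [? _|]; first exact: ch.
rewrite openE => -[s t] [/= As Bt]; exists (A, B) => //=.
by split; exact: open_nbhs_nbhs.
Qed.

Lemma ball0_open (e : R) : open [set s : R | `|s| < e].
Proof.
have -> : [set s : R | `|s| < e] = ball 0 e.
  by rewrite eqEsubset; split=> s; rewrite /ball /= sub0r normrN.
exact: ball_open.
Qed.

Lemma half_open (e : R) b : open (half e b).
Proof.
have -> : half e b = [set s : R | `|s| < e] `&` (if b then [set s | s < 0] else [set s | s > 0]).
  rewrite eqEsubset; split=> s [se s0]; split => //; move: s0;
  by case: b; rewrite /= ?expr1 ?expr0; lra.
apply: openI; first exact: ball0_open.
by case: b; [exact: open_lt | exact: open_gt].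
Qed.

End HalfIntervals.

Section Curve.
Variables (R : realType) (gamma : R -> R3 R) (K : set (R3 R)).
Hypothesis Kgamma : parametrizes gamma K.

Let pr (t : R) : R2 R := (gamma t).1.

Lemma projectionP z : projection K z <-> exists t, z = pr t.
Proof.
have [_ _ ->] := Kgamma; split=> [[_ [t _ <-] <-]|[t ->]]; first by exists t.
by exists (gamma t) => //; exists t.
Qed.

Lemma projection_gamma t : projection K (pr t).
Proof. by apply/projectionP; exists t. Qed.

Lemma gamma_shift t s : gamma s = gamma t -> forall r, gamma (s + r) = gamma (t + r).
Proof.
have [_ gE _] := Kgamma => /gE st r; apply/gE.
by have -> : t + r - (s + r) = t - s by ring.
Qed.

Lemma continuous_pr : continuous pr.
Proof.
have [cg _ _] := Kgamma => t.
by apply: (continuous_comp (cg t)); exact: cvg_fst.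
Qed.

Lemma noncrossing_inj s t : ~ crossing K (pr t) -> pr s = pr t -> gamma s = gamma t.
Proof.
have [_ _ KE] := Kgamma => nc st; apply: contrapT => ne; apply: nc.
by exists (gamma s), (gamma t); rewrite KE; split.
Qed.

(* A crossing_chart stripped of the heights, hence symmetric in the two
   strands. *)
Definition double_point (p : R2 R) t t' (h : R2 R -> R2 R) e : Prop :=
  [/\ pr t = p /\ pr t' = p,
      homeomorphism h /\ 0 < e,
      forall s, `|s| < e -> h (pr (t + s)) = (s, 0),
      forall s, `|s| < e -> h (pr (t' + s)) = (0, s)
    & forall r, open_square e (h (pr r)) ->
        exists2 s, `|s| < e &
          gamma r = gamma (t + s) \/ gamma r = gamma (t' + s)].

Definition flip (h : R2 R -> R2 R) (z : R2 R) : R2 R := ((h z).2, (h z).1).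

Lemma crossing_chart_double p t t' h e :
  crossing_chart gamma p t t' h e -> double_point p t t' h e.
Proof. by move=> [[? ? _] ? ? ? ?]; split. Qed.

Lemma flip_homeomorphism h : homeomorphism h -> homeomorphism (flip h).
Proof.
move=> [ch [g cg [hK gK]]]; split.
  move=> z; apply: (@continuous_comp _ _ _ h (@unstable.swap R R)).
    exact: ch.
  exact: swap_continuous.
exists (fun z => g (z.2, z.1)).
  move=> z; apply: (@continuous_comp _ _ _ (@unstable.swap R R) g).
    exact: swap_continuous.
  exact: cg.
by split=> -[u v]; rewrite /flip /= -?surjective_pairing ?hK ?gK.
Qed.

Lemma double_point_flip p t t' h e :
  double_point p t t' h e -> double_point p t' t (flip h) e.
Proof.
move=> [[pt pt'] [hh e0] ht ht' hc]; split => //.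
- by split=> //; exact: flip_homeomorphism.
- by move=> s se; rewrite /flip ht'.
- by move=> s se; rewrite /flip ht.
- move=> r [r1 r2]; have [|s se [|]] := hc r; first by split.
    by exists s => //; right.
  by exists s => //; left.
Qed.

Lemma quadrant_flip (h : R2 R -> R2 R) e b1 b2 :
  quadrant (flip h) e b1 b2 = quadrant h e b2 b1.
Proof. by rewrite eqEsubset; split=> z [[? ?] ? ?]; split=> //; split. Qed.

Section Chart.
Variables (p : R2 R) (t t' : R) (h : R2 R -> R2 R) (e : R).
Hypothesis hp : double_point p t t' h e.

Lemma chart_origin : h p = (0, 0).
Proof.
have [[<- _] [_ e0] ht _ _] := hp.
by rewrite -[in LHS](addr0 t) ht ?normr0.
Qed.

Lemma chart_origin_square : open_square e (h p).
Proof. by have [_ [_ e0] _ _ _] := hp; rewrite chart_origin; split; rewrite normr0. Qed.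

Lemma chart_axis1 z : open_square e (h z) -> (h z).2 = 0 -> z = pr (t + (h z).1).
Proof.
have [_ [hh e0] ht _ _] := hp => -[z1 _] z2; apply: (homeomorphism_inj hh).
by rewrite ht // {1}(surjective_pairing (h z)) z2.
Qed.

Lemma chart_noncrossing s : s != 0 -> `|s| < e -> ~ crossing K (pr (t + s)).
Proof.
have [_ [hh e0] ht ht' hc] := hp => s0 se.
suff E r : pr r = pr (t + s) -> gamma r = gamma (t + s).
  have [_ _ KE] := Kgamma.
  move=> [u [v]]; rewrite KE => -[[r _ <-] [r' _ <-] ne /E r1 /E r2].
  by apply: ne; rewrite r1 r2.
move=> rs; have hr : h (pr r) = (s, 0) by rewrite rs ht.
have [|s' se' [g|g]] := hc r; first by rewrite hr; split; rewrite //= normr0.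
  by move: hr; rewrite /pr g -/(pr _) ht // => -[<-].
by move: hr; rewrite /pr g -/(pr _) ht' // => -[s00]; rewrite -s00 eqxx in s0.
Qed.

Lemma gamma_over_point r : pr r = p -> gamma r = gamma t \/ gamma r = gamma t'.
Proof.
have [_ [hh e0] ht ht' hc] := hp => rp.
have [|s se sE] := hc r; first by rewrite rp; exact: chart_origin_square.
have hr := chart_origin; case: sE => gr; [left|right]; rewrite gr.
  by move: hr; rewrite -rp /pr gr -/(pr _) ht // => -[->]; rewrite addr0.
by move: hr; rewrite -rp /pr gr -/(pr _) ht' // => -[->]; rewrite addr0.
Qed.

Lemma quadrant_off b1 b2 z : quadrant h e b1 b2 z -> ~ projection K z.
Proof.
have [_ [hh e0] ht ht' hc] := hp => -[zs z1 z2] /projectionP[r zr].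
have [|s se [g|g]] := hc r; first by rewrite -zr.
  by move: z2; rewrite zr /pr g -/(pr _) ht //= mulr0 ltxx.
by move: z1; rewrite zr /pr g -/(pr _) ht' //= mulr0 ltxx.
Qed.

Lemma half_edge_exists (pK : crossing K p) b : finite_set (crossing K) ->
  exists a1 a2, consecutive gamma K a1 a2 /\ (if b then a2 else a1) = t.
Proof.
have [[pt _] [hh e0] _ _ _] := hp => fK.
have gE s : (s = 1) \/ (s = -1) -> pr (t + s) = p.
  move=> s1; rewrite -pt /pr; congr (_.1); have [_ gE _] := Kgamma; apply/gE.
  have -> : t - (t + s) = - s by ring.
  by case: s1 => ->; rewrite ?opprK ?rpredN rpred1.
have e1 : e <= 1.
  rewrite leNgt; apply/negP => e1; apply: (@chart_noncrossing 1) => //.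
    by rewrite normr1.
  by rewrite gE //; left.
have cK : closed (crossing K).
  by apply: (accessible_finite_set_closed.1 _) => //;
    apply: hausdorff_accessible; exact: norm_hausdorff.
have cKp : closed (pr @^-1` crossing K).
  by apply: preimage_closed => // s _; exact: continuous_pr.
have cS u v : compact (`[u, v] `&` pr @^-1` crossing K).
  by apply: compact_closedI => //; exact: segment_compact.
have cI (S : set R) : {within S, continuous (id : R -> R)}.
  by apply: continuous_subspaceT => s; exact: cvg_id.
have near r : `|r - t| < e -> r != t -> ~ crossing K (pr r).
  move=> rt nrt; rewrite -(subrKC t r); apply: chart_noncrossing => //.
  by rewrite subr_eq0.
case: b.
- have S0 : `[t - 1, t - e / 2] `&` pr @^-1` crossing K !=set0.
    exists (t - 1); split => /=; first by rewrite in_itv /=; apply/andP; split; lra.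
    by rewrite gE //; right.
  have [c /set_mem[/= ct ck] cmax] := compact_EVT_max S0 (cS _ _) (cI _).
  move: ct; rewrite in_itv /= => /andP[c1 c2].
  exists c, t; split=> //; split => //; first by lra.
    by rewrite -/(pr t) pt.
  move=> r /andP[cr rt] kr; have [re|re] := ltP (t - e / 2) r.
    apply: (near r) => //; last by rewrite lt_eqF.
    by rewrite ltr_norml; apply/andP; split; lra.
  have : r <= c by apply: cmax; rewrite inE /= in_itv /=; split=> //; apply/andP; split; lra.
  lra.
- have S0 : `[t + e / 2, t + 1] `&` pr @^-1` crossing K !=set0.
    exists (t + 1); split => /=; first by rewrite in_itv /=; apply/andP; split; lra.
    by rewrite gE //; left.
  have [c /set_mem[/= ct ck] cmax] := compact_EVT_min S0 (cS _ _) (cI _).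
  move: ct; rewrite in_itv /= => /andP[c1 c2].
  exists t, c; split=> //; split => //; first by lra.
    by rewrite -/(pr t) pt.
  move=> r /andP[cr rt] kr; have [re|re] := ltP r (t + e / 2).
    apply: (near r) => //; last by rewrite gt_eqF.
    by rewrite ltr_norml; apply/andP; split; lra.
  have : c <= r by apply: cmax; rewrite inE /= in_itv /=; split=> //; apply/andP; split; lra.
  lra.
Qed.

End Chart.

Lemma quadrant_cover p t t' h e z : double_point p t t' h e ->
  open_square e (h z) -> ~ projection K z -> exists b1 b2, quadrant h e b1 b2 z.
Proof.
move=> hp zs zK.
have z2 : (h z).2 != 0.
  apply/eqP => z2; apply: zK; rewrite (chart_axis1 hp zs z2).
  exact: projection_gamma.
have z1 : (h z).1 != 0.
  apply/eqP => z1; apply: zK.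
  have zs' : open_square e (flip h z) by case: zs.
  rewrite (chart_axis1 (double_point_flip hp) zs' z1).
  exact: projection_gamma.
have [b1 ?] := half_neq0 z1; have [b2 ?] := half_neq0 z2.
by exists b1, b2.
Qed.

Lemma same_edge_ends a b a' b' :
  consecutive gamma K a b -> consecutive gamma K a' b' ->
  pr @` [set t | a < t < b] = pr @` [set t | a' < t < b'] ->
  gamma a = gamma a' /\ gamma b = gamma b'.
Proof.
move=> [ab ka kb nab] [ab' ka' kb' nab'] E.
pose m := (a + b) / 2; have mab : a < m < b by rewrite /m; apply/andP; split; lra.
have [r rab rm] : (pr @` [set t | a' < t < b']) (pr m) by rewrite -E; exists m.
have /gamma_shift sh : gamma r = gamma m by apply: noncrossing_inj => //; exact: nab.
have sh1 s : gamma s = gamma (s + (r - m)).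
  have := sh (s - m); rewrite subrKC => <-; congr gamma; ring.
have sh2 s : gamma s = gamma (s - (r - m)).
  by rewrite [RHS]sh1; congr gamma; ring.
have Ea : a + (r - m) = a'.
  move: mab rab => /= /andP[? ?] /andP[? ?].
  have [h|h|//] := ltgtP (a + (r - m)) a'.
    case: (nab (a' - (r - m))); first by apply/andP; split; lra.
    by rewrite -sh2.
  case: (nab' (a + (r - m))); first by apply/andP; split; lra.
  by rewrite -sh1.
have Eb : b + (r - m) = b'.
  move: mab rab => /= /andP[? ?] /andP[? ?].
  have [h|h|//] := ltgtP (b + (r - m)) b'.
    case: (nab' (b + (r - m))); first by apply/andP; split; lra.
    by rewrite -sh1.
  case: (nab (b' - (r - m))); first by apply/andP; split; lra.
  by rewrite -sh2.
by rewrite -Ea -Eb -!sh1.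
Qed.

End Curve.

Lemma boolNE (b c : bool) : b <> c -> b = ~~ c.
Proof. by case: b c => -[]. Qed.

(** * Domains around a crossing *)

Section Domains.
Variables (R : realType) (K : set (R3 R)) (gamma : R -> R3 R).
Variables (n : nat) (x : 'I_n.+1 -> set (R2 R)) (col : 'I_n.+1 -> bool).
Hypothesis Kgamma : parametrizes gamma K.
Hypothesis Kregular : regular_projection gamma K.
Hypothesis Kalternating : alternating_projection gamma K.
Hypothesis Kdomains : domains K x.
Hypothesis Kcommon : common gamma K x.
Hypothesis Kcol : chessboard gamma K x col.

Let pr (t : R) : R2 R := (gamma t).1.
Let arc a b : set (R2 R) := pr @` [set t | a < t < b].

Lemma domain_off i z : x i z -> ~ projection K z.
Proof.
have [_ xE _] := Kdomains; have [q qK xi] := (xE (x i)).1 (ex_intro _ i erefl).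
by rewrite xi => xz; exact: (connected_component_sub xz).
Qed.

Lemma domain_absorb i A z : connected A -> A `<=` ~` projection K -> A z -> x i z ->
  A `<=` x i.
Proof.
have [_ xE _] := Kdomains; have [q qK ->] := (xE (x i)).1 (ex_intro _ i erefl).
move=> cA AK Az /same_connected_component ->.
exact: connected_component_max.
Qed.

Lemma domain_exists z : ~ projection K z -> exists i, x i z.
Proof.
have [_ xE _] := Kdomains => zK.
have [i xi] := (xE (connected_component (~` projection K) z)).2 (ex_intro2 _ _ z zK erefl).
by exists i; rewrite -xi; exact: connected_component_refl.
Qed.

Lemma domain_inj i j z : x i z -> x j z -> i = j.
Proof.
have [xI xE _] := Kdomains => xi xj; apply: xI; move: xi xj.
have [q qK ->] := (xE (x i)).1 (ex_intro _ i erefl).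
have [q' qK' ->] := (xE (x j)).1 (ex_intro _ j erefl).
by move=> /same_connected_component -> /same_connected_component ->.
Qed.

Lemma quadrant_domain p t t' h e b1 b2 z i : double_point gamma p t t' h e ->
  quadrant h e b1 b2 z -> x i z -> quadrant h e b1 b2 `<=` x i.
Proof.
move=> hp qz xz; have [_ [hh _] _ _ _] := hp.
apply: domain_absorb qz xz; first exact: quadrant_connected.
by move=> y /(quadrant_off Kgamma hp).
Qed.

Lemma quadrant_nonempty p t t' h e b1 b2 :
  double_point gamma p t t' h e -> quadrant h e b1 b2 !=set0.
Proof.
move=> [_ [[_ [g _ [_ gK]]] e0] _ _ _]; rewrite quadrantE.
exists (g ((-1) ^+ b1 * Num.min e e / 2, (-1) ^+ b2 * Num.min e e / 2)).
by split=> /=; rewrite gK; exact: half_small.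
Qed.

Lemma quadrant_in_domain p t t' h e b1 b2 :
  double_point gamma p t t' h e -> exists i, quadrant h e b1 b2 `<=` x i.
Proof.
move=> hp; have [z qz] := quadrant_nonempty b1 b2 hp.
have [i xz] := domain_exists (quadrant_off Kgamma hp qz).
by exists i; exact: (quadrant_domain hp qz xz).
Qed.

Lemma boundary_closure i t : closure (x i) (pr t) -> boundary (x i) (pr t).
Proof.
move=> ct; split=> // /interior_subset /domain_off; apply.
exact: (projection_gamma Kgamma).
Qed.

(* Along an edge, having a given domain on one side is an open and closed
   condition. *)
Lemma arc_boundary i a b r : consecutive gamma K a b -> a < r < b ->
  closure (x i) (pr r) -> arc a b `<=` boundary (x i).
Proof.
move=> [_ _ _ nab] rab cr _ [t tab <-]; apply: boundary_closure.
pose C := pr @^-1` closure (x i).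
suff E : [set t | a < t < b] `&` C = [set t | a < t < b].
  by move: (tab); rewrite -E => -[].
have cab : connected [set t : R | a < t < b].
  apply/connected_intervalP => u v /= /andP[? ?] /andP[? ?] w /andP[? ?].
  by apply/andP; split; lra.
apply: cab.
- by exists r.
- exists (interior C); first exact: open_interior.
  rewrite eqEsubset; split=> s [sab Cs]; split=> //; last exact: interior_subset Cs.
  have [_ _ fl] := Kregular.
  have [h [e [hh e0 hs hc]]] := fl s (nab _ sab).
  have [z [xz [z1 z2]]] : x i `&` h @^-1` ([set u | `|u| < e] `*` [set u | `|u| < e]) !=set0.
    apply: Cs; apply: open_nbhs_nbhs; split.
      by apply: open_rect => //; exact: ball0_open.
    by rewrite /= -(addr0 s) hs ?normr0 //; split; rewrite /= normr0.
  have z0 : (h z).2 != 0.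
    apply/eqP => z0; apply: (domain_off xz).
    have -> : z = pr (s + (h z).1).
      by apply: (homeomorphism_inj hh); rewrite hs // {1}(surjective_pairing (h z)) z0.
    exact: (projection_gamma Kgamma).
  have [c zc] := half_neq0 z0.
  have sub : h @^-1` ([set u | `|u| < e] `*` half e c) `<=` x i.
    apply: (@domain_absorb _ _ z) => //.
      apply: preimage_connected => //; apply: connected_setX.
        exact: ball0_connected.
      exact: half_connected.
    move=> y [y1 [y2 y0]] /(projectionP Kgamma)[v yv].
    have [|w we gw] := hc v; first by rewrite -yv.
    by move: y0; rewrite yv gw hs //= mulr0 ltxx.
  apply/nbhs_ballP; exists e => // u; rewrite /ball /= => us.
  have -> : u = s + (u - s) by rewrite subrKC.
  apply: (closureS sub); apply: (@closure_half _ _ _ _ (u - s)) => //=.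
    by rewrite distrC.
  by rewrite hs // distrC.
- exists C => //; apply: preimage_closed; last exact: closed_closure.
  by move=> ? _; exact: (continuous_pr Kgamma).
Qed.

Section HalfEdge.
Variables (p : R2 R) (t t' : R) (h : R2 R -> R2 R) (e a1 a2 : R) (b : bool).
Hypothesis hp : double_point gamma p t t' h e.
Hypothesis ca : consecutive gamma K a1 a2.
Hypothesis at_t : gamma (if b then a2 else a1) = gamma t.

Let u := (-1) ^+ b * Num.min e (a2 - a1) / 2.
Let r := (if b then a2 else a1) + u.

Local Lemma half_edge_point : [/\ a1 < r < a2, half e b u & h (pr r) = (u, 0)].
Proof.
have [_ [hh e0] ht _ _] := hp; have [a12 _ _ _] := ca.
have d0 : 0 < a2 - a1 by rewrite subr_gt0.
have ub := half_small b e0 d0.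
have [ud _] : half (a2 - a1) b u by rewrite /u minC; exact: half_small.
split => //.
  case: (ub) => _; rewrite -/u => u0.
  rewrite /r; move: ud u0; rewrite ltr_norml => /andP[].
  by case: (b); rewrite /= ?expr1 ?expr0 => ? ? ?; apply/andP; split; lra.
by rewrite /r /pr (gamma_shift Kgamma at_t) -/(pr _) ht //; case: ub.
Qed.

Lemma quadrant_boundary b2 i : quadrant h e b b2 `<=` x i -> arc a1 a2 `<=` boundary (x i).
Proof.
have [ra ub hr] := half_edge_point; have [_ [hh e0] _ _ _] := hp => q.
apply: arc_boundary ra _ => //; apply: (closureS q); rewrite quadrantE.
exact: closure_half ub hr.
Qed.

Lemma boundary_quadrant i : arc a1 a2 `<=` boundary (x i) ->
  exists b2, quadrant h e b b2 `<=` x i.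
Proof.
have [ra ub hr] := half_edge_point; have [_ [hh e0] _ _ _] := hp => ax.
have [cl _] : boundary (x i) (pr r) by apply: ax; exists r.
have [z [xz [z1 z2]]] : x i `&` h @^-1` (half e b `*` [set u | `|u| < e]) !=set0.
  apply: cl; apply: open_nbhs_nbhs; split.
    by apply: open_rect => //; [exact: half_open | exact: ball0_open].
  by rewrite /= hr; split=> //=; rewrite normr0.
have [|b1 [b2 qz]] := quadrant_cover Kgamma hp _ (domain_off xz).
  by split=> //; case: z1.
exists b2; apply: (quadrant_domain hp _ xz).
suff bb1 : b = b1 by rewrite bb1.
case: qz z1 => _ + _ [_]; case: (b); case: (b1) => //=; rewrite ?expr1 ?expr0; lra.
Qed.

End HalfEdge.

(* The overcrossing strand separates x i from x j and x k from x l. *)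
Definition local_relator p i j k l : Prop := exists t t' h e b1 b2,
  [/\ crossing_chart gamma p t t' h e,
      quadrant h e b1 b2 `<=` x i,
      quadrant h e b1 (~~ b2) `<=` x j,
      quadrant h e (~~ b1) (~~ b2) `<=` x k
    & quadrant h e (~~ b1) b2 `<=` x l].

Lemma normalizedP p i j k l : normalized gamma K x col p i j k l <->
  [/\ crossing K p, source col i /\ source col k, sink col j /\ sink col l
    & local_relator p i j k l].
Proof.
split=> [[pK ik jl [r [m [[a [b [c [d [-> ]]]]]]]]]|[pK ik jl ijkl]]; last first.
  split=> //; exists [:: pos i; neg j; pos k; neg l], 0%N; split; last by left.
  by exists i, j, k, l.
move=> [t [t' [h [e [b1 [b2 [hc qa qb qc qd]]]]]]] E; split=> //; exists t, t', h, e.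
case: E; case: m => [|[|[|[|m]]]] // [-> -> -> ->].
- by exists b1, b2; split.
- by exists (~~ b1), (~~ b2); rewrite !negbK; split.
- by exists b1, b2; split.
- by exists (~~ b1), b2; rewrite !negbK; split.
- by exists b1, (~~ b2); rewrite !negbK; split.
- by exists (~~ b1), b2; rewrite !negbK; split.
Qed.

Lemma normalized_rot p i j k l :
  normalized gamma K x col p i j k l -> normalized gamma K x col p k l i j.
Proof.
move=> /normalizedP[pK [? ?] [? ?] [t [t' [h [e [b1 [b2 [? ? ? ? ?]]]]]]]].
apply/normalizedP; split=> //.
by exists t, t', h, e, (~~ b1), (~~ b2); rewrite !negbK; split.
Qed.

Lemma local_set p i j k l (s : {set 'I_n.+1}) : local_relator p i j k l -> #|s| = 4%N ->
  (forall i, i \in s <-> boundary (x i) p) ->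
  s = [set v in [:: i; j; k; l]] /\ uniq [:: i; j; k; l].
Proof.
move=> [t [t' [h [e [b1 [b2 [/crossing_chart_double hp qi qj qk ql]]]]]]] s4 sE.
have sub : {subset s <= [:: i; j; k; l]}.
  move=> v /sE [cl _]; have [_ [hh e0] _ _ _] := hp.
  have [z [xz [z1 z2]]] : x v `&` h @^-1` ([set u | `|u| < e] `*` [set u | `|u| < e]) !=set0.
    apply: cl; apply: open_nbhs_nbhs; split.
      by apply: open_rect => //; exact: ball0_open.
    exact: chart_origin_square hp.
  have [|c1 [c2 qz]] := quadrant_cover Kgamma hp _ (domain_off xz); first by split.
  have : [\/ v = i, v = j, v = k | v = l].
    have [c1E|/eqP/boolNE c1E] := eqVneq c1 b1; have [c2E|/eqP/boolNE c2E] := eqVneq c2 b2;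
      rewrite c1E c2E in qz.
    - by constructor 1; apply: domain_inj xz (qi _ qz).
    - by constructor 2; apply: domain_inj xz (qj _ qz).
    - by constructor 4; apply: domain_inj xz (ql _ qz).
    - by constructor 3; apply: domain_inj xz (qk _ qz).
  by case=> ->; rewrite !inE eqxx ?orbT.
have card_le : (#|[set v in [:: i; j; k; l]]| <= #|s|)%N.
  by rewrite s4 cardsE; exact: card_size.
have E : s = [set v in [:: i; j; k; l]].
  by apply/eqP; rewrite eqEcard card_le andbT; apply/fintype.subsetP => v /sub; rewrite finset.in_set.
split=> //; apply/card_uniqP; rewrite [RHS]/= -s4 E.
by apply: eq_card => v; rewrite finset.in_set.
Qed.

Lemma local_uniq p i j k l : crossing K p -> local_relator p i j k l -> uniq [:: i; j; k; l].
Proof.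
move=> pK L; have [_ /(_ p pK)[s s4 sE]] := Kcommon.
by have [] := local_set L s4 sE.
Qed.

Lemma local_same p i j k l i' j' k' l' : crossing K p ->
  local_relator p i j k l -> local_relator p i' j' k' l' -> [:: i; j; k; l] =i [:: i'; j'; k'; l'].
Proof.
move=> pK L L' v; have [_ /(_ p pK)[s s4 sE]] := Kcommon.
have [E _] := local_set L s4 sE; have [E' _] := local_set L' s4 sE.
have : (v \in s) = (v \in s) by []; by rewrite {1}E {1}E' !inE.
Qed.

Definition end_of (a1 a2 : R) (b : bool) : R := if b then a2 else a1.

Lemma over_edge p i j k l : crossing K p -> local_relator p i j k l ->
  exists a1 a2 b,
    [/\ consecutive gamma K a1 a2, pr (end_of a1 a2 b) = p,
        overcrossing K (gamma (end_of a1 a2 b))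
      & common_edge gamma K (x i) (x j) (arc a1 a2)].
Proof.
move=> pK [t [t' [h [e [b1 [b2 [hc qi qj _ _]]]]]]].
have hp := crossing_chart_double hc.
have [fK _ _] := Kregular.
have [a1 [a2 [ca tE]]] := half_edge_exists Kgamma hp pK b1 fK.
have at_t : gamma (if b1 then a2 else a1) = gamma t by rewrite tE.
exists a1, a2, b1; rewrite /end_of tE; case: hc => -[pt pt' ht] _ _ _ _.
have [_ _ KE] := Kgamma.
split=> //.
- by exists (gamma t'); rewrite pt pt' KE; split=> //; exists t'.
- split; first by exists a1, a2.
    exact: (quadrant_boundary hp ca at_t qi).
  exact: (quadrant_boundary hp ca at_t qj).
Qed.

Lemma under_edge p i j k l : crossing K p -> local_relator p i j k l ->
  exists a1 a2 b,
    [/\ consecutive gamma K a1 a2, pr (end_of a1 a2 b) = p,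
        ~ overcrossing K (gamma (end_of a1 a2 b))
      & common_edge gamma K (x i) (x l) (arc a1 a2)].
Proof.
move=> pK [t [t' [h [e [b1 [b2 [hc qi _ _ ql]]]]]]].
have hp := crossing_chart_double hc.
have hq := double_point_flip hp.
have [fK _ _] := Kregular.
have [a1 [a2 [ca tE]]] := half_edge_exists Kgamma hq pK b2 fK.
have at_t : gamma (if b2 then a2 else a1) = gamma t' by rewrite tE.
exists a1, a2, b2; rewrite /end_of tE; case: hc => -[pt pt' ht] _ _ _ _.
rewrite -!(quadrant_flip h) in qi ql.
split=> //.
- move=> [v []]; have [_ _ ->] := Kgamma => -[r _ <-].
  rewrite pt' => /(gamma_over_point hp)[->|->]; last by rewrite ltxx.
  by rewrite ltNge (ltW ht).
- split; first by exists a1, a2.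
    exact: (quadrant_boundary hq ca at_t qi).
  exact: (quadrant_boundary hq ca at_t ql).
Qed.

Lemma same_end a1 a2 b a1' a2' b' :
  consecutive gamma K a1 a2 -> consecutive gamma K a1' a2' ->
  arc a1 a2 = arc a1' a2' ->
  (overcrossing K (gamma (end_of a1 a2 b)) <->
   overcrossing K (gamma (end_of a1' a2' b'))) ->
  pr (end_of a1 a2 b) = pr (end_of a1' a2' b').
Proof.
move=> c c' E; have [E1 E2] := same_edge_ends Kgamma c c' E.
have := Kalternating c; rewrite /end_of /pr.
by case: b b' => -[]; rewrite -?E1 -?E2 //; tauto.
Qed.

Lemma normalized_over p i j k l p' k' l' :
  normalized gamma K x col p i j k l -> normalized gamma K x col p' i j k' l' ->
  k = k' /\ l = l'.
Proof.
move=> /normalizedP[pK [si sk] [tj tl] L] /normalizedP[pK' [_ sk'] [_ tl'] L'].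
have [a1 [a2 [b [c pE o cE]]]] := over_edge pK L.
have [a1' [a2' [b' [c' pE' o' cE']]]] := over_edge pK' L'.
have U := local_uniq pK L; have U' := local_uniq pK' L'.
have ij : i != j by move: U => /= /andP[]; rewrite !inE !negb_or => /and3P[].
have [co _] := Kcommon; have aE := co _ _ _ _ ij cE cE'.
have pp : p = p' by rewrite -pE -pE'; apply: same_end.
rewrite -{}pp in L' pK' => {pE' o' c'}.
have S := local_same pK L L'.
have := S k; have := S l; rewrite !inE !eqxx !orbT.
move: U; rewrite /= !inE !negb_or => /and3P[/and3P[_ ik il] /andP[jk jl] _].
rewrite (eq_sym k i) (eq_sym k j) (eq_sym l i) (eq_sym l j).
rewrite (negbTE ik) (negbTE il) (negbTE jk) (negbTE jl) /=.
move=> /esym/orP[/eqP lk'|/eqP ->]; first by rewrite /sink lk' in tl.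
by move=> /esym/orP[/eqP -> //|/eqP kl']; rewrite /source kl' in sk.
Qed.

Lemma normalized_under p i j k l p' j' k' :
  normalized gamma K x col p i j k l -> normalized gamma K x col p' i j' k' l ->
  j = j' /\ k = k'.
Proof.
move=> /normalizedP[pK [si sk] [tj tl] L] /normalizedP[pK' [_ sk'] [tj' _] L'].
have [a1 [a2 [b [c pE o cE]]]] := under_edge pK L.
have [a1' [a2' [b' [c' pE' o' cE']]]] := under_edge pK' L'.
have U := local_uniq pK L; have U' := local_uniq pK' L'.
have il : i != l by move: U => /= /andP[]; rewrite !inE !negb_or => /and3P[].
have [co _] := Kcommon; have aE := co _ _ _ _ il cE cE'.
have pp : p = p' by rewrite -pE -pE'; apply: same_end.
rewrite -{}pp in L' pK' => {pE' o' c'}.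
have S := local_same pK L L'.
have := S k; have := S j; rewrite !inE !eqxx !orbT.
move: U; rewrite /= !inE !negb_or => /and3P[/and3P[ij ik _] /andP[_ jl] kl].
rewrite (eq_sym k i) (eq_sym j i).
move: kl; rewrite (negbTE ij) (negbTE ik) (negbTE jl) andbT => /negbTE -> /=.
rewrite !orbF => /esym/orP[/eqP ->|/eqP jk']; last by rewrite /sink jk' in tj.
by move=> /esym/orP[/eqP kj'|/eqP -> //]; rewrite /source kj' in sk.
Qed.

Lemma outer_normalized l E : sink col l ->
  common_edge gamma K (x ord0) (x l) E -> exists p j k,
    [/\ normalized gamma K x col p ord0 j k l, uniq [:: ord0; j; k; l]
      & exists E', common_edge gamma K (x ord0) (x j) E'].
Proof.
move=> tl [[a1 [a2 [c ->]]] E0 El].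
have [b ob] : exists b, ~ overcrossing K (gamma (end_of a1 a2 b)).
  have [ov|ov] := pselect (overcrossing K (gamma a1)); last by exists false.
  by exists true; exact: (Kalternating c).1 ov.
set p := pr (end_of a1 a2 b).
have pK : crossing K p by case: c => _ k1 k2 _; rewrite /p; case: (b).
have [fK /(_ p pK)[t [t' [h [e hc]]]] _] := Kregular.
have hp := crossing_chart_double hc; have hq := double_point_flip hp.
have at_t' : gamma (if b then a2 else a1) = gamma t'.
  have [//|gt] := gamma_over_point hq (r := end_of a1 a2 b) erefl.
  case: ob; rewrite gt; case: hc => -[pt pt' ht] _ _ _ _.
  by exists (gamma t'); have [_ _ ->] := Kgamma; rewrite pt pt'; split=> //; exists t'.
have [b1] := boundary_quadrant hq c at_t' E0; rewrite quadrant_flip => q0.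
have [b1'] := boundary_quadrant hq c at_t' El; rewrite quadrant_flip => ql.
have b1E : b1' = ~~ b1.
  apply: boolNE => b1E; rewrite {}b1E in ql; have [z qz] := quadrant_nonempty b1 b hp.
  by apply: tl; rewrite (domain_inj (ql _ qz) (q0 _ qz)).
rewrite {}b1E in ql.
have [j qj] := quadrant_in_domain b1 (~~ b) hp.
have [k qk] := quadrant_in_domain (~~ b1) (~~ b) hp.
have L : local_relator p ord0 j k l by exists t, t', h, e, b1, b.
have U := local_uniq pK L.
have [a [a' [d [_ _ _ cE]]]] := over_edge pK L.
have L' : local_relator p j ord0 l k by exists t, t', h, e, b1, (~~ b); rewrite negbK.
have [a3 [a3' [d' [_ _ _ cE']]]] := under_edge pK L'.
move: (U); rewrite /= !inE !negb_or => /and3P[/and3P[n0j n0k n0l] /andP[njk njl] nkl].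
have c0j := Kcol n0j cE; have cjk := Kcol njk cE'.
exists p, j, k; split=> //; last by exists (arc a a').
apply/normalizedP; split=> //; split=> //; rewrite /source ?/sink.
  by move: c0j cjk; case: (col ord0); case: (col j); case: (col k).
by move=> ce; rewrite ce eqxx in c0j.
Qed.

End Domains.

(** * Critical pairs *)

Section CriticalPairs.
Variables (W : Type) (S : rewriting_system W).

Definition joinable (u v : seq W) : Prop := exists2 z, steps S u z & steps S v z.

Lemma steps_refl u : steps S u u.
Proof. exact: rt_refl. Qed.

Lemma step_ctx u v a b : step S a b -> step S (u ++ a ++ v) (u ++ b ++ v).
Proof.
move=> [u' [v' [l [r [Slr -> ->]]]]]; exists (u ++ u'), (v' ++ v), l, r.
by split; rewrite -?catA.
Qed.

Lemma steps_ctx u v a b : steps S a b -> steps S (u ++ a ++ v) (u ++ b ++ v).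
Proof.
elim=> [c d cd||c d e _ IH1 _ IH2]; last exact: rt_trans IH1 IH2.
  by apply: rt_step; exact: step_ctx.
by move=> ?; exact: rt_refl.
Qed.

Lemma rule_steps m l r w z : S l r -> w = take m w ++ l ++ drop (m + size l) w ->
  steps S (take m w ++ r ++ drop (m + size l) w) z -> steps S w z.
Proof.
move=> Slr wE; apply: rt_trans; apply: rt_step.
by exists (take m w), (drop (m + size l) w), l, r.
Qed.

Lemma joinable_ctx u v a b : joinable a b -> joinable (u ++ a ++ v) (u ++ b ++ v).
Proof. by move=> [z az bz]; exists (u ++ z ++ v); exact: steps_ctx. Qed.

Lemma joinable_sym a b : joinable a b -> joinable b a.
Proof. by move=> [z ? ?]; exists z. Qed.

Lemma cat_split (u v u' v' : seq W) : u ++ v = u' ++ v' -> (size u <= size u')%N ->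
  exists d, u' = u ++ d /\ v = d ++ v'.
Proof.
elim: u u' => [u' /= -> _|a u IH [|b u'] //= [-> /IH{}IH] /IH[d [-> ->]]].
  by exists u'.
by exists d.
Qed.

Lemma critical_pairs :
  (forall r, ~ S [::] r) ->
  (forall a b c r r', b <> [::] -> S (a ++ b) r -> S (b ++ c) r' ->
     joinable (r ++ c) (a ++ r')) ->
  (forall a b c r r', S (a ++ b ++ c) r -> S b r' -> joinable r (a ++ r' ++ c)) ->
  locally_confluent S.
Proof.
move=> S0 over incl.
suff le p1 l1 r1 q1 p2 l2 r2 q2 : S l1 r1 -> S l2 r2 ->
    p1 ++ l1 ++ q1 = p2 ++ l2 ++ q2 -> (size p1 <= size p2)%N ->
    joinable (p1 ++ r1 ++ q1) (p2 ++ r2 ++ q2).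
  move=> w u v [p1 [q1 [l1 [r1 [S1 -> ->]]]]] [p2 [q2 [l2 [r2 [S2 E ->]]]]].
  have [?|/ltnW ?] := leqP (size p1) (size p2); first exact: le E _.
  by apply: joinable_sym; exact: le (esym E) _.
move=> S1 S2 E /(cat_split E)[d [-> {}E]]; rewrite -catA.
have [le|lt] := leqP (size l1) (size d).
  have [d' [-> ->]] := cat_split E le.
  exists (p1 ++ r1 ++ d' ++ r2 ++ q2); apply: rt_step.
    by exists (p1 ++ r1 ++ d'), q2, l2, r2; split=> //; rewrite -!catA.
  by exists p1, (d' ++ r2 ++ q2), l1, r1; split=> //; rewrite -!catA.
have [b [l1E E']] := cat_split (esym E) (ltnW lt).
have [bl|/ltnW bl] := leqP (size b) (size l2).
  have [c [l2E ->]] := cat_split (esym E') bl.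
  rewrite (catA r1) (catA d); apply: joinable_ctx.
  apply: (over _ b) => [b0||]; first by rewrite l1E b0 cats0 ltnn in lt.
    by rewrite -l1E.
  by rewrite -l2E.
have [c [bE ->]] := cat_split E' bl.
have -> : d ++ r2 ++ c ++ q1 = (d ++ r2 ++ c) ++ q1 by rewrite -!catA.
apply: joinable_ctx.
apply: (incl _ l2) => //.
by rewrite -bE -l1E.
Qed.

End CriticalPairs.

(** * The rewriting system *)

Section System.
Variables (R : realType) (K : set (R3 R)) (gamma : R -> R3 R).
Variables (n : nat) (x : 'I_n.+1 -> set (R2 R)) (col : 'I_n.+1 -> bool).
Hypothesis Kgamma : parametrizes gamma K.
Hypothesis Kregular : regular_projection gamma K.
Hypothesis Kalternating : alternating_projection gamma K.
Hypothesis Kdomains : domains K x.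
Hypothesis Kcommon : common gamma K x.
Hypothesis Kcol : chessboard gamma K x col.

Local Notation normal := (normalized gamma K x col).
Local Notation SK := (sigma_kappa gamma K x col).
Local Notation inner := (inner_relator gamma K x col).
Local Notation Tw := (Tword gamma K x col).
Local Notation Sys := (Re'' gamma K x col).

Definition src (i : 'I_n) : bool := col (domain_of i) == col ord0.
Definition out (q : 'I_n) : bool := `[< outer gamma K x col q >].

Lemma domain_of_inj : injective (@domain_of n).
Proof. exact: lift_inj. Qed.

Lemma domain_of_neq0 (i : 'I_n) : domain_of i <> ord0.
Proof. by apply/eqP; rewrite eq_sym; exact: neq_lift. Qed.

Lemma domain_ofP (i : 'I_n.+1) : i != ord0 -> exists i', i = domain_of i'.
Proof. by case: (unliftP ord0 i) => [i' -> _|->]; [exists i' | rewrite eqxx]. Qed.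

Lemma source_src i : source col (domain_of i) -> src i = true.
Proof. by move=> /eqP. Qed.

Lemma sink_src i : sink col (domain_of i) -> src i = false.
Proof. by move=> /eqP/negbTE. Qed.

Lemma SK_fun l j k j' k' : SK l j k -> SK l j' k' -> j = j' /\ k = k'.
Proof.
move=> [_ [p N]] [_ [p' N']].
by have [/domain_of_inj -> /domain_of_inj ->] :=
  normalized_under Kgamma Kregular Kalternating Kdomains Kcommon N N'.
Qed.

Lemma SK_inj l l' j k k' : SK l j k -> SK l' j k' -> l = l' /\ k = k'.
Proof.
move=> [_ [p N]] [_ [p' N']].
by have [/domain_of_inj -> /domain_of_inj ->] :=
  normalized_over Kgamma Kregular Kalternating Kdomains Kcommon N N'.
Qed.

Lemma SK_exists l : out l -> exists j k, SK l j k /\ out j.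
Proof.
move=> /asboolP ol; have [tl [E cE]] := ol.
have [p [j [k [N U oj]]]] := outer_normalized Kgamma Kregular Kalternating
  Kdomains Kcommon Kcol tl cE.
move: U; rewrite /= !inE !negb_or => /and3P[/and3P[j0 k0 _] _ _].
have [j' jE] : exists j', j = domain_of j' by apply: domain_ofP; rewrite eq_sym.
have [k' kE] : exists k', k = domain_of k' by apply: domain_ofP; rewrite eq_sym.
rewrite {}jE {}kE in N oj; exists j', k'; split; first by split=> //; exists p.
by apply/asboolP; split=> //; case: N => _ _ [].
Qed.

Lemma SK_type l j k : SK l j k ->
  [/\ src l = false, src j = false, src k = true, out l = true & out j = true].
Proof.
move=> S; have [ol [p [_ [_ /source_src k1] [/sink_src j1 /sink_src l1] _]]] := S.
have ol' : out l by apply/asboolP.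
split=> //; have [j' [k' [S' oj]]] := SK_exists ol'.
by have [-> _] := SK_fun S S'.
Qed.

Lemma inner_type m p m' q : inner m p m' q ->
  [/\ src m = true, src p = false, src m' = true & src q = false].
Proof.
move=> [c _ [_ [/source_src ? /source_src ?] [/sink_src ? /sink_src ?] _]].
by split.
Qed.

Lemma inner_rot m p m' q : inner m p m' q -> inner m' q m p.
Proof. by move=> [c c0 /normalized_rot N]; exists c. Qed.

Lemma inner_over m p m' q m1 q1 : inner m p m' q -> inner m p m1 q1 ->
  m' = m1 /\ q = q1.
Proof.
move=> [c _ N] [c' _ N'].
by have [/domain_of_inj -> /domain_of_inj ->] :=
  normalized_over Kgamma Kregular Kalternating Kdomains Kcommon N N'.
Qed.

Lemma inner_under m p m' q p1 m1 : inner m p m' q -> inner m p1 m1 q ->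
  p = p1 /\ m' = m1.
Proof.
move=> [c _ N] [c' _ N'].
by have [/domain_of_inj -> /domain_of_inj ->] :=
  normalized_under Kgamma Kregular Kalternating Kdomains Kcommon N N'.
Qed.

Lemma inner_SK_over m p m' q j : inner m p m' q -> SK p j m -> False.
Proof.
move=> [c _ N] [_ [p' /normalized_rot N']].
by have [/domain_of_neq0] :=
  normalized_over Kgamma Kregular Kalternating Kdomains Kcommon N N'.
Qed.

Lemma inner_SK_under m p m' q l : inner m p m' q -> SK l q m -> False.
Proof.
move=> [c _ N] [_ [p' /normalized_rot N']].
by have [_ /domain_of_neq0] :=
  normalized_under Kgamma Kregular Kalternating Kdomains Kcommon N N'.
Qed.

Lemma Tword_fun q w w' : Tw q w -> Tw q w' -> w = w'.
Proof.
move=> [[j [k [S ->]]]|[nq ->]] [[j' [k' [S' ->]]]|[nq' ->]] //.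
- by have [-> ->] := SK_fun S S'.
- by case: S => ? _; case: nq'.
- by case: S' => ? _; case: nq.
Qed.

Lemma Tword_cases q w : Tw q w ->
  (exists j k j' k', [/\ out q = true, SK q j k, SK j j' k' & w = [:: neg j; pos k]]) \/
  out q = false /\ w = [:: pos q].
Proof.
move=> [[j [k [S ->]]]|[nq ->]]; last by right; split=> //; apply/asboolPn.
have [_ _ _ oq /SK_exists[j' [k' [S' _]]]] := SK_type S.
by left; exists j, k, j', k'.
Qed.

Lemma Tword_exists q : exists w, Tw q w.
Proof.
have [/SK_exists[j [k [S _]]]|/asboolPn nq] := boolP (out q).
  by exists [:: neg j; pos k]; left; exists j, k.
by exists [:: pos q]; right.
Qed.

(* The position of the redex, counted from the left, comes first. *)
Local Ltac rw m H := apply: (rule_steps (m := m) H) => //=.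
Local Ltac end_steps := exact: steps_refl.

(* [T(q)] represents [t_q]. *)
Lemma Tword_neg q w : Tw q w -> steps Sys (w ++ [:: neg q]) [::].
Proof.
move=> /Tword_cases[[j [k [j' [k' [_ S S' ->]]]]]|[_ ->]] /=.
  rw 1%N (rule2' S S'); rw 0%N (rule3 S'); rw 0%N (rule0' gamma K x col k').
  end_steps.
by rw 0%N (rule0 gamma K x col q); end_steps.
Qed.

Lemma neg_Tword q w : Tw q w -> steps Sys (neg q :: w) [::].
Proof.
move=> /Tword_cases[[j [k [j' [k' [_ S S' ->]]]]]|[_ ->]] /=.
  rw 0%N (rule3 S); rw 0%N (rule0' gamma K x col k).
  end_steps.
by rw 0%N (rule0' gamma K x col q); end_steps.
Qed.

(* The sources add one and the sinks triple, so that moving a source to the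
   right past a sink pays for the sources that the rule creates. *)
Definition weight (m : nat) (a : letter 'I_n) : nat :=
  (if src a.1 then m.+1 else if out a.1 && ~~ a.2 then 3 * m + 2 else 3 * m)%N.

Definition weights (m : nat) (w : word 'I_n) : nat := foldl weight m w.

Lemma weights_lt w m m' : (m < m')%N -> (weights m w < weights m' w)%N.
Proof.
elim: w m m' => //= a w IH m m' mm'; apply: IH; rewrite /weight.
by case: (src _); [|case: ifP => _]; lia.
Qed.

Lemma weights_gt0 w m : (0 < m)%N -> (0 < weights m w)%N.
Proof.
elim: w m => //= a w IH m m0; apply: IH; rewrite /weight.
by case: (src _); [|case: ifP => _]; lia.
Qed.

Lemma rule_weights l r m : Sys l r -> (0 < m)%N -> (weights m r < weights m l)%N.
Proof.
move=> H m0; case: H; rewrite /weights /= /weight.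
- by move=> i /=; case: (src i) => //; case: (out i) => /=; lia.
- by move=> i /=; case: (src i) => //; case: (out i) => /=; lia.
- by move=> {}l j k /SK_type[/= -> -> -> -> ->] /=; lia.
- move=> {}l j k l' k' /SK_type[/= -> _ -> _ _] /SK_type[/= _ -> -> _ _].
  by rewrite !andbF; lia.
- by move=> {}l j k /SK_type[/= -> -> -> _ _]; rewrite !andbF; lia.
- move=> {}l j k l' k' /SK_type[/= -> _ -> _ _] /SK_type[/= _ -> -> _ _].
  by rewrite !andbF; lia.
- move=> m1 p m' q w /inner_type[/= -> -> sm' sq] /Tword_cases[].
    move=> [j [k [j' [k' [_ /SK_type[_ sj sk _ _] _ ->]]]]] /=.
    by rewrite sm' sj sk !andbF; lia.
  by move=> [oq ->] /=; rewrite sm' sq oq !andbF /=; lia.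
- move=> m1 p m' q /inner_type[/= -> -> -> ->] _.
  by case: (out q); rewrite !andbF /=; lia.
- move=> m1 p m' q j k /inner_type[/= -> -> -> _] /SK_type[_ -> -> _ _].
  by rewrite !andbF; lia.
Qed.

Lemma step_weights u v : step Sys u v -> (weights 1 v < weights 1 u)%N.
Proof.
move=> [p [s [l [r [H -> ->]]]]]; rewrite /weights !foldl_cat.
by apply: weights_lt; apply: rule_weights => //; exact: weights_gt0.
Qed.

Lemma terminating_Re'' : terminating Sys.
Proof.
move=> [w wS].
have le i : (weights 1 (w i) + i <= weights 1 (w 0%N))%N.
  by elim: i => [|i IH]; [rewrite addn0 | have := step_weights (wS i); lia].
by have := le (weights 1 (w 0%N)).+1; lia.
Qed.

Lemma rule_size l r : Sys l r -> (size l <= 2)%N /\ (size r <= 3)%N.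
Proof.
case=> // m p m' q w _ [[j [k [_ ->]]]|[_ ->]] //.
Qed.

Lemma finite_Re'' : finite_system Sys.
Proof.
pose f (t : 3.-tuple (option (letter 'I_n)) * 3.-tuple (option (letter 'I_n))) :=
  (pmap id t.1, pmap id t.2).
have fE (w : word 'I_n) : (size w <= 3)%N ->
    exists t : 3.-tuple (option (letter 'I_n)), w = pmap id t.
  move=> w3; have s3 : size (map Some w ++ nseq (3 - size w) None) == 3%N.
    by rewrite size_cat size_map size_nseq subnKC.
  exists (Tuple s3) => /=; rewrite pmap_cat map_pK //.
  by elim: (3 - size w)%N => [|k IH]; rewrite ?cats0.
apply: (@sub_finite_set _ _ (range f)); last by apply: finite_image; exact: finite_finset.
move=> [l r] /= /rule_size[/leqW/fE[t ->] /fE[t' ->]].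
by exists (t, t').
Qed.

Lemma SK_next l j k : SK l j k -> exists l' k', SK j l' k' /\ out l'.
Proof. by move=> /SK_type[_ _ _ _ /SK_exists]. Qed.

Lemma inner_steps m p m' q : inner m p m' q ->
  steps Sys [:: neg p; pos m'; neg q] [:: neg m].
Proof.
move=> /inner_rot I; have [w T] := Tword_exists p.
have : steps Sys [:: pos m'; neg q] (w ++ [:: neg m]).
  by rewrite cats1; rw 0%N (rulea I T); rewrite cats0; end_steps.
move=> /(steps_ctx [:: neg p] [::]); rewrite !cats0 => pq; apply: rt_trans pq _.
exact: (steps_ctx [::] [:: neg m] (neg_Tword T)).
Qed.

Local Ltac clash :=
  exfalso;
  repeat match goal with
  | H : SK _ _ _ |- _ => generalize (SK_type H); revert H
  | H : inner _ _ _ _ |- _ => generalize (inner_type H); revert H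
  | H : ~ outer _ _ _ _ _ |- _ => move: H => /asboolPn/negbTE H; rewrite -/(out _) in H
  end;
  intros;
  repeat match goal with
  | H : [/\ _, _, _ & _] |- _ => destruct H
  | H : [/\ _, _, _, _ & _] |- _ => destruct H
  end;
  unfold pos, neg in *; congruence.

Lemma overlapping_rules a b c L1 L2 r r' : Sys L1 r -> Sys L2 r' ->
  L1 = [:: a; b] -> L2 = [:: b; c] -> joinable Sys (r ++ [:: c]) (a :: r').
Proof.
case=> [i|i|l j k S|l j k l' k' S S'|l j k S|l j k l' k' S S'
  |m p m' q w I T|m p m' q I nq|m p m' q j k I S];
case=> [i2|i2|l2 j2 k2 S2|l2 j2 k2 l2' k2' S2 S2'|l2 j2 k2 S2|l2 j2 k2 l2' k2' S2 S2'
  |m2 p2 m2' q2 w2 I2 T2|m2 p2 m2' q2 I2 nq2|m2 p2 m2' q2 j2 k2 I2 S2] E1 E2;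
  try clash.
all: move: E1 E2; case=> <- <-; case=> e <- /=.
- by rewrite e; exists [:: pos i]; end_steps.
- subst l2; exists [:: neg j2]; first by end_steps.
  rw 0%N (rule1 S2); rw 1%N (rule0 gamma K x col k2); end_steps.
- subst k2; exists [:: neg l2']; first by end_steps.
  rw 0%N (rule2' S2 S2'); rw 1%N (rule0 gamma K x col k2'); end_steps.
- subst m2; exists [:: pos q2]; first by end_steps.
  have Tq : Tw q2 [:: pos q2] by right.
  rw 0%N (rulea I2 Tq); rw 1%N (rule0' gamma K x col m2'); end_steps.
- subst m2; exists [:: neg j2]; first by end_steps.
  have Tq : Tw q2 [:: neg j2; pos k2] by left; exists j2, k2.
  rw 0%N (rulea I2 Tq); rw 2%N (rule0' gamma K x col m2').
  rw 1%N (rule0 gamma K x col k2); end_steps.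
- by rewrite e; exists [:: neg i]; end_steps.
- subst k2; exists [:: neg l2]; first by end_steps.
  rw 0%N (rule4 S2 S2'); rw 1%N (rule0' gamma K x col k2'); end_steps.
- subst m2; exists [:: neg p2]; first by end_steps.
  case: T2 => [[j [k [S ->]]]|[nq ->]] /=.
    rw 0%N (rule5 I2 S); rw 2%N (rule0' gamma K x col k).
    rw 1%N (rule0 gamma K x col m2'); end_steps.
  rw 0%N (ruleb I2 nq); rw 1%N (rule0 gamma K x col m2'); end_steps.
- subst i2; have [l'' [k'' [S'' _]]] := SK_next S'; exists [:: pos k]; last by end_steps.
  rw 2%N (rule1 S); rw 1%N (rule2' S' S''); rw 0%N (rule3 S'').
  rw 0%N (rule0' gamma K x col k''); end_steps.
- subst l2; have [l'' [k'' [S'' _]]] := SK_next S'; have [ej ek] := SK_fun S2 S; subst j2 k2.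
  exists [::]; last by rw 0%N (rule0 gamma K x col k); end_steps.
  rw 1%N (rule2' S' S''); rw 0%N (rule3 S''); rw 0%N (rule0' gamma K x col k'').
  end_steps.
- subst i2; have [l' [k' [S' _]]] := SK_next S; exists [:: neg l]; last by end_steps.
  rw 1%N (rule1 S'); rw 0%N (rule4 S S'); rw 1%N (rule0' gamma K x col k'); end_steps.
- subst l2; exists [:: neg l; neg k2]; last by end_steps.
  rw 0%N (rule4 S S2); end_steps.
- subst i2; have [l'' [k'' [S'' _]]] := SK_next S'; exists [:: neg k]; last by end_steps.
  rw 2%N (rule1 S''); rw 1%N (rule4 S' S''); rw 2%N (rule0' gamma K x col k'').
  rw 0%N (rule3 S); end_steps.
- subst l2; exists [:: neg k; neg k2]; last by end_steps.
  rw 1%N (rule4 S' S2); rw 0%N (rule3 S); end_steps.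
- subst i2; have Iq := inner_rot I; exists [:: pos m]; last by end_steps.
  rewrite -cats1 -catA /=.
  suff: steps Sys [:: neg m'; pos p] [:: neg q; pos m].
    move=> /(steps_ctx w [::]); rewrite !cats0 => pq; apply: rt_trans pq _.
    by have := steps_ctx [::] [:: pos m] (Tword_neg T); rewrite /= -catA.
  have [/SK_exists[j [k [S _]]]|/asboolPn np] := boolP (out p).
    rw 1%N (rule1 S); rw 0%N (rule5 Iq S); rw 2%N (rule0' gamma K x col k).
    end_steps.
  rw 0%N (ruleb Iq np); end_steps.
- subst l2; have Iq := inner_rot I; exists [:: pos m; neg k2]; last by end_steps.
  rewrite -cats1 -catA /=.
  have : steps Sys [:: neg m'; neg j2] [:: neg q; pos m; neg k2].
    rw 0%N (rule5 Iq S2); end_steps.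
  move=> /(steps_ctx w [::]); rewrite !cats0 => pq; apply: rt_trans pq _.
  by have := steps_ctx [::] [:: pos m; neg k2] (Tword_neg T); rewrite /= -catA.
- subst i2; exists [:: neg m]; last by end_steps.
  exact: inner_steps I.
- subst i2; have [l' [k' [S' _]]] := SK_next S; exists [:: neg m]; last by end_steps.
  rw 3%N (rule1 S'); rw 2%N (rule4 S S'); rw 3%N (rule0' gamma K x col k').
  exact: inner_steps I.
- subst l2; exists [:: neg m; neg k2]; last by end_steps.
  rw 2%N (rule4 S S2).
  exact: (steps_ctx [::] [:: neg k2] (inner_steps I)).
Qed.

Lemma nested_rules a b L1 L2 r r' : Sys L1 r -> Sys L2 r' ->
  L1 = [:: a; b] -> L2 = [:: b] -> joinable Sys r (a :: r').
Proof.
case=> [i|i|l j k S|l j k l' k' S S'|l j k S|l j k l' k' S S'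
  |m p m' q w I T|m p m' q I nq|m p m' q j k I S];
case=> [i2|i2|l2 j2 k2 S2|l2 j2 k2 l2' k2' S2 S2'|l2 j2 k2 S2|l2 j2 k2 l2' k2' S2 S2'
  |m2 p2 m2' q2 w2 I2 T2|m2 p2 m2' q2 I2 nq2|m2 p2 m2' q2 j2 k2 I2 S2] E1 E2;
  try clash.
move: E1 E2 => [<- <-] [e]; subst i; exists [::]; first by end_steps.
rw 0%N (rule3 S2); rw 0%N (rule0' gamma K x col k2); end_steps.
Qed.

Lemma prefix_rules a b L1 L2 r r' : Sys L1 r -> Sys L2 r' ->
  L1 = [:: a; b] -> L2 = [:: a] -> joinable Sys r (r' ++ [:: b]).
Proof.
case=> [i|i|l j k S|l j k l' k' S S'|l j k S|l j k l' k' S S'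
  |m p m' q w I T|m p m' q I nq|m p m' q j k I S];
case=> [i2|i2|l2 j2 k2 S2|l2 j2 k2 l2' k2' S2 S2'|l2 j2 k2 S2|l2 j2 k2 l2' k2' S2 S2'
  |m2 p2 m2' q2 w2 I2 T2|m2 p2 m2' q2 I2 nq2|m2 p2 m2' q2 j2 k2 I2 S2] E1 E2;
  try clash.
move: E1 E2 => [<- <-] [e]; subst i; exists [::]; first by end_steps.
have [l' [k' [S' _]]] := SK_next S2.
rw 1%N (rule2' S2 S'); rw 0%N (rule3 S'); rw 0%N (rule0' gamma K x col k').
end_steps.
Qed.

Lemma rule_functional L1 L2 r r' : Sys L1 r -> Sys L2 r' -> L1 = L2 -> r = r'.
Proof.
case=> [i|i|l j k S|l j k l' k' S S'|l j k S|l j k l' k' S S'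
  |m p m' q w I T|m p m' q I nq|m p m' q j k I S];
case=> [i2|i2|l2 j2 k2 S2|l2 j2 k2 l2' k2' S2 S2'|l2 j2 k2 S2|l2 j2 k2 l2' k2' S2 S2'
  |m2 p2 m2' q2 w2 I2 T2|m2 p2 m2' q2 I2 nq2|m2 p2 m2' q2 j2 k2 I2 S2] E1;
  try clash.
all: move: E1 => // -[].
- by move=> e; subst l2; have [-> ->] := SK_fun S S2.
- move=> _ e; subst l2; have [e _] := SK_fun S S2; subst j2.
  by have [-> ->] := SK_fun S' S2'.
- by move=> e1 e2; subst m2 p2; case: (inner_SK_over I2 S).
- by move=> e1 e2; subst l2 j2; have [_ ->] := SK_fun S S2.
- move=> e1 e2; subst k2 l2'; have [e _] := SK_inj S' S2'; subst j2.
  by have [-> _] := SK_inj S S2; have [_ ->] := SK_fun S' S2'.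
- move=> e1 e2; subst m2 j2; have [e _] := SK_inj S' S2; subst q2.
  by case: (inner_SK_under I2 S).
- by move=> e1 e2; subst m p; case: (inner_SK_over I S2).
- move=> e1 e2; subst m2 p2; have [e1 e2] := inner_over I I2; subst m2' q2.
  by rewrite (Tword_fun T T2).
- by move=> e1 e2; subst m2 q2; have [-> ->] := inner_under I I2.
- move=> e1 e2; subst m j; have [e _] := SK_inj S S2'; subst q.
  by case: (inner_SK_under I S2).
- move=> e1 e2; subst m2 j2; have [e ->] := SK_inj S S2; subst q2.
  by have [-> ->] := inner_under I I2.
Qed.

Lemma locally_confluent_Re'' : locally_confluent Sys.
Proof.
have no_nil l r : Sys l r -> l <> [::] by case.
have eq l r r' : Sys l r -> Sys l r' -> joinable Sys r r'.
  by move=> S1 S2; rewrite (rule_functional S1 S2 erefl); exists r'; exact: steps_refl.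
apply: critical_pairs => [r /no_nil //|a b c r r' b0 S1 S2|a b c r r' S1 S2].
  have [] := (rule_size S1, rule_size S2); rewrite !size_cat => -[s1 _] [s2 _].
  case: a b c b0 S1 S2 s1 s2 => [|a1 [|a2 a]] [|b1 [|b2 [|b3 b]]] [|c1 [|c2 c]] //=
    _ S1 S2 s1 s2; try (by exfalso; lia); rewrite ?cats0.
  - exact: eq S1 S2.
  - by apply: joinable_sym; exact: prefix_rules S2 S1 erefl erefl.
  - exact: eq S1 S2.
  - exact: nested_rules S1 S2 erefl erefl.
  - exact: overlapping_rules S1 S2 erefl erefl.
have b0 := no_nil _ _ S2.
have [] := rule_size S1; rewrite !size_cat => s1 _.
case: a b c b0 S1 S2 s1 => [|a1 [|a2 a]] [|b1 [|b2 [|b3 b]]] [|c1 [|c2 c]] //=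
  _ S1 S2 s1; try (by exfalso; lia); rewrite ?cats0.
- exact: eq S1 S2.
- exact: prefix_rules S1 S2 erefl erefl.
- exact: eq S1 S2.
- exact: nested_rules S1 S2 erefl erefl.
Qed.

End System.

Theorem theorem5p5 (R : realType) (K : set (R3 R)) (gamma : R -> R3 R)
    (n : nat) (x : 'I_n.+1 -> set (R2 R)) (col : 'I_n.+1 -> bool)
    (Kgamma : parametrizes gamma K)
    (Ktame : tame K) (Kprime : prime_knot K)
    (Kregular : regular_projection gamma K)
    (Kalternating : alternating_projection gamma K)
    (Kdomains : domains K x) (Kcommon : common gamma K x)
    (Kcol : chessboard gamma K x col) :
  finite_system (Re'' gamma K x col) /\ complete_system (Re'' gamma K x col).
Proof.
split; first exact: finite_Re''.
by split; [exact: terminating_Re''|exact: locally_confluent_Re''].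
Qed.
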